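(* Let $n\ge5$ and let $\alpha,\beta\in\mathcal{E}_n=\mathrm{End}(\mathcal{T}_n)$. (1) If $\alpha\in\mathcal{E}_n\setminus\mathcal{G}_n$ then the principal left ideal generated by $\alpha$ is $\mathcal{E}_n\alpha=\{\alpha,\alpha^+,\alpha^-,\alpha^0\}$. (2) $\alpha\mathrel{\mathscr{L}}\beta$ if and only if $\mathrm{im}\,\alpha=\mathrm{im}\,\beta$ if and only if $\alpha=\beta$ or $\alpha,\beta\in\mathcal{G}_n$.
   Context: Maps are written on the right and composed left to right. $\mathcal{T}_n$ is the full transformation semigroup of all maps $\{1,\dots,n\}\to\{1,\dots,n\}$; $\mathcal{S}_n$, $\mathcal{A}_n$ are the symmetric and alternating groups, $\mathrm{id}$ the identity map, and $s^g=g^{-1}sg$ for $g\in\mathcal{S}_n$, $s\in\mathcal{T}_n$. $\mathcal{E}_n=\mathrm{End}(\mathcal{T}_n)$ is the monoid of all semigroup endomorphisms of $\mathcal{T}_n$ (not required to fix $\mathrm{id}$), and $\mathcal{G}_n=\mathrm{Aut}(\mathcal{T}_n)$. For $g\in\mathcal{S}_n$, $\psi_g:s\mapsto s^g$. For $t,e\in\mathcal{T}_n$, $\phi_{t,e}$ sends $s\mapsto t$ if $s\in\mathcal{S}_n\setminus\mathcal{A}_n$, $s\mapsto t^2$ if $s\in\mathcal{A}_n$, $s\mapsto e$ if $s\in\mathcal{T}_n\setminus\mathcal{S}_n$. By a known theorem of Schein and Teclezghi, $\mathcal{G}_n=\{\psi_g:g\in\mathcal{S}_n\}$ and, for $n\neq4$,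 $\mathcal{E}_n=\mathcal{G}_n\cup\{\phi_{t,e}: t^3=t,\ te=et=e^2=e\}$. For singular $\alpha$, i.e. $\alpha=\phi_{t,e}\in\mathcal{E}_n\setminus\mathcal{G}_n$: $\alpha^+=\phi_{t^2,e}$ (equal to $\gamma\alpha$ for any $\gamma=\phi_{u,f}\in\mathcal{E}_n$ with $u\in\mathcal{A}_n$, $f\neq\mathrm{id}$); $\alpha^-=\phi_{e,e}$ (equal to $\gamma\alpha$ for any $\gamma=\phi_{u,f}\in\mathcal{E}_n$ with $u\notin\mathcal{S}_n$); $\alpha^0=\phi_{t^2,t^2}$ (equal to $\phi_{\mathrm{id},\mathrm{id}}\alpha$). $\mathscr{L}$ is Green's relation on $\mathcal{E}_n$: $\alpha\mathrel{\mathscr{L}}\beta$ iff $\mathcal{E}_n\alpha=\mathcal{E}_n\beta$. $\mathrm{im}\,\alpha$ is the image of $\alpha$. *)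

(* Defs.v *)
From HB Require Import structures.
From mathcomp Require Import all_boot all_fingroup all_solvable.

Set Implicit Arguments.
Unset Strict Implicit.
Unset Printing Implicit Defensive.

Local Open Scope group_scope.

(* The full transformation monoid on X.  It is an alias of {ffun X -> X},      *)
(* needed because {ffun X -> X} already carries a pointwise product when X is  *)
(* itself a magma.  Maps act on the right: s * t is "first s, then t".         *)
Definition transf (X : finType) : Type := {ffun X -> X}.

HB.instance Definition _ (X : finType) := Finite.on (transf X).

Section TransfMonoid.

Variable X : finType.
Implicit Types s t u : transf X.

Definition transf_mul s t : transf X := [ffun x : X => t (s x)].
Definition transf_one : transf X := [ffun x : X => x].

Fact transf_mulA : associative transf_mul.
Proof. by move=> s t u; apply/ffunP=> x; rewrite !ffunE. Qed.

Fact transf_mul1 : left_id transf_one transf_mul.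
Proof. by move=> s; apply/ffunP=> x; rewrite !ffunE. Qed.

Fact transf_1mul : right_id transf_one transf_mul.
Proof. by move=> s; apply/ffunP=> x; rewrite !ffunE. Qed.

End TransfMonoid.

HB.instance Definition _ (X : finType) :=
  isMonoid.Build (transf X) (@transf_mulA X) (@transf_mul1 X) (@transf_1mul X).

(* T_n; the points 1, ..., n are represented by 0, ..., n - 1.                 *)
Notation T n := (transf 'I_n).

Section Endomorphisms.

Variable n : nat.

Definition perm_transf (g : 'S_n) : T n := [ffun x : 'I_n => g x].

Definition symT : {set T n} := [set perm_transf g | g in 'Sym_('I_n)].
Definition altT : {set T n} := [set perm_transf g | g in 'Alt_('I_n)].

(* Endomorphisms preserve products but need not preserve 1.  They are elements *)
(* of the transformation monoid on the set T n, so a * b is "first a, then b". *)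
Definition EndT : {set transf (T n)} :=
  [set a : transf (T n) |
    [forall s : T n, forall t : T n, a (s * t) == a s * a t]].

Definition im (a : transf (T n)) : {set T n} := [set a s | s : T n].

Definition AutT : {set transf (T n)} :=
  [set a in EndT | injectiveb a & im a == [set: T n]].

Definition phi (t e : T n) : transf (T n) :=
  [ffun s : T n => if s \notin symT then e else if s \in altT then t ^+ 2 else t].

Definition lideal (a : transf (T n)) : {set transf (T n)} :=
  [set c * a | c : transf (T n) in EndT].

Definition greenL (a b : transf (T n)) : Prop := lideal a = lideal b.

(* For a = phi t e these are a^+, a^- and a^0; they depend on a only, since    *)
(* (t, e) is determined by phi t e as soon as n >= 2.                          *)
Definition phi_plus (t e : T n) : transf (T n) := phi (t ^+ 2) e.
Definition phi_minus (t e : T n) : transf (T n) := phi e e.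
Definition phi_zero (t e : T n) : transf (T n) := phi (t ^+ 2) (t ^+ 2).

End Endomorphisms.

(* Main.v *)
Require Import Defs.
From mathcomp Require Import all_boot all_fingroup all_solvable.

(** The proof rests on the classification of the non-injective endomorphisms
    [a] of T_n for n >= 5: each of them is [phi t e] for a pair satisfying
    [phi_pair] ([singular_endo]).  It splits according to whether [a] is
    injective on the symmetric group.

    If [a] is injective on S_n, then the identity of the group a(S_n) must be 1
    and [a] permutes S_n ([endo_unit_inj]).  If [a] identified two distinct
    singular maps, it would identify two constants, hence by 2-transitivity all
    of them, and their common image would be a map fixed under right
    multiplication by every permutation, which is absurd.  So [a] is injective
    ([endo_inj]).

    If [a] is not injective on S_n, then its kernel there is a nontrivial normal
    subgroup, so it contains A_n by simplicity of A_n ([alt_in_kernel]).  The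
    idempotents [collapse i j] of rank n - 1 are conjugate under A_n, so they
    all have the same image e.  A constant is a product of such idempotents, so
    it also goes to e; and a singular map s satisfies s = s * collapse i j for
    any point i missed by s, so that a(s) = a(s) e is the image of
    s * cst k = cst k, which is e ([endo_singular]).  Thus [a] has the form
    [phi t e], with t the image of a transposition.

    The image of [phi t e] is the monoid {t, t^2, e} with identity t^2 and zero
    e, and this determines t and e ([phi_im_inj]).  Since AutT consists of the
    endomorphisms with full image, endomorphisms with the same image are equal
    or both automorphisms ([im_endo]), while L-equivalent maps clearly have the
    same image.  Finally, for c singular, c * phi t e is
    computed directly ([mul_phi]), and for c an automorphism c * phi t e has the
    image of phi t e, so equals it by the same uniqueness ([lideal_phi]). *)

Local Open Scope group_scope.

(** * Permutations among the transformations *)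

Lemma transf_mulE {X : finType} (s t : transf X) x : (s * t) x = t (s x).
Proof. by rewrite ffunE. Qed.

Lemma transf_oneE {X : finType} x : (1 : transf X) x = x.
Proof. by rewrite ffunE. Qed.

Lemma perm_transfM {n} (g h : 'S_n) :
  perm_transf (g * h) = perm_transf g * perm_transf h.
Proof. by apply/ffunP=> x; rewrite transf_mulE !ffunE permM. Qed.

Lemma perm_transf1 {n} : perm_transf (1 : 'S_n) = 1.
Proof. by apply/ffunP=> x; rewrite transf_oneE ffunE perm1. Qed.

Lemma perm_transf_inj {n} : injective (@perm_transf n).
Proof.
by move=> g h /ffunP gh; apply/permP=> x; have:= gh x; rewrite !ffunE.
Qed.

Lemma symTP {n} (s : T n) :
  reflect (exists g, s = perm_transf g) (s \in symT n).
Proof.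
apply: (iffP imsetP) => [[g _ ->]|[g ->]]; first by exists g.
by exists g; rewrite ?inE.
Qed.

Lemma mem_symT {n} (g : 'S_n) : perm_transf g \in symT n.
Proof. by apply/symTP; exists g. Qed.

Lemma mem_altT {n} (g : 'S_n) : (perm_transf g \in altT n) = ~~ odd_perm g.
Proof. by rewrite mem_imset ?Alt_even //; apply: perm_transf_inj. Qed.

Lemma symT_injP {n} (s : T n) : reflect (injective s) (s \in symT n).
Proof.
apply: (iffP (symTP s)) => [[g ->] x y|s_inj].
  by rewrite !ffunE => /perm_inj.
by exists (perm s_inj); apply/ffunP=> x; rewrite ffunE permE.
Qed.

Lemma symT_mul {n} (s t : T n) :
  (s * t \in symT n) = (s \in symT n) && (t \in symT n).
Proof.
apply/idP/andP => [|[/symTP[g ->] /symTP[h ->]]]; last first.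
  by rewrite -perm_transfM mem_symT.
move=> st; have s_sym: s \in symT n.
  apply/symT_injP=> x y sxy; apply: (symT_injP _ st).
  by rewrite !transf_mulE sxy.
split=> //; have /symTP[g sE] := s_sym; have /symTP[h stE] := st.
apply/symTP; exists (g^-1 * h).
by rewrite perm_transfM -stE sE mulgA -perm_transfM mulVg perm_transf1 mul1g.
Qed.

Lemma idem_symT {n} (s : T n) : s \in symT n -> s * s = s -> s = 1.
Proof.
move=> /symTP[g ->]; rewrite -perm_transfM => /perm_transf_inj gg.
by rewrite -perm_transf1; congr perm_transf; apply: (mulgI g); rewrite mulg1.
Qed.

(** * Points and constant maps *)

Lemma fresh_point {n} (l : seq 'I_n) : (size l < n)%N -> exists x, x \notin l.
Proof.
move=> l_lt; case: (pickP [pred x | x \notin l]) => [x /= xl|all_l].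
  by exists x.
suff: (n <= size l)%N by rewrite leqNgt l_lt.
rewrite -{1}[n]card_ord; apply: leq_trans (card_size l).
by apply/subset_leq_card/subsetP=> x _; move/negbFE: (all_l x).
Qed.

Definition cst {n} (k : 'I_n) : T n := [ffun=> k].

Lemma mul_cst {n} (s : T n) k : s * cst k = cst k.
Proof. by apply/ffunP=> x; rewrite transf_mulE !ffunE. Qed.

Lemma cst_mul {n} (s : T n) k : cst k * s = cst (s k).
Proof. by apply/ffunP=> x; rewrite transf_mulE !ffunE. Qed.

Lemma cst_inj {n} : injective (@cst n).
Proof. by move=> k l /ffunP/(_ k); rewrite !ffunE. Qed.

Lemma cst_singular {n} (k : 'I_n) : (1 < n)%N -> cst k \notin symT n.
Proof.
move=> n_gt1; apply/negP=> /symT_injP cst_injective.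
have [x] := fresh_point [:: k] n_gt1.
by rewrite inE => /eqP[]; apply: cst_injective; rewrite !ffunE.
Qed.

(** * Endomorphisms *)

Lemma endoP {n} {a : transf (T n)} :
  reflect (forall s t, a (s * t) = a s * a t) (a \in EndT n).
Proof.
rewrite inE; apply: (iffP forallP) => [aM s t|aM s].
  by have /forallP/(_ t)/eqP := aM s.
by apply/forallP=> t; rewrite aM.
Qed.

Lemma mem_im {n} (a : transf (T n)) s : a s \in im a.
Proof. by apply: imset_f. Qed.

Lemma AutTP {n} (a : transf (T n)) : a \in EndT n ->
  (a \in AutT n <-> injective a).
Proof.
move=> a_end; rewrite inE a_end /=; split=> [/andP[/injectiveP]|] // a_inj.
apply/andP; split; first exact/injectiveP.
apply/eqP/setP=> s; rewrite inE.
by have [b _ ab] := injF_bij a_inj; rewrite -[s]ab mem_im.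
Qed.

Lemma AutT_im {n} (a : transf (T n)) : a \in EndT n ->
  (a \in AutT n) = (im a == [set: T n]).
Proof.
move=> a_end; rewrite inE a_end /= andb_idl // => /eqP im_a; apply/injectiveP.
have /imset_injP a_inj: #|im a| == #|{: T n}| by rewrite im_a cardsT.
by move=> s u; apply: a_inj.
Qed.

(** * The singular endomorphisms phi t e *)

Definition phi_pair {n} (t e : T n) : Prop :=
  [/\ t ^+ 3 = t, t * e = e, e * t = e & e ^+ 2 = e].

Lemma phi_perm {n} (t e : T n) g :
  phi t e (perm_transf g) = if odd_perm g then t else t ^+ 2.
Proof. by rewrite ffunE mem_symT mem_altT if_neg. Qed.

Lemma phi_sing {n} (t e s : T n) : s \notin symT n -> phi t e s = e.
Proof. by rewrite ffunE => ->. Qed.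

Lemma phi_one {n} (t e : T n) : phi t e 1 = t ^+ 2.
Proof. by rewrite -perm_transf1 phi_perm odd_perm1. Qed.

Lemma phi_val {n} (t e s : T n) :
  [\/ phi t e s = t, phi t e s = t ^+ 2 | phi t e s = e].
Proof.
by rewrite ffunE; case: ifP => _; last case: ifP => _;
  [constructor 3 | constructor 2 | constructor 1].
Qed.

Section PhiPair.

Context {n : nat} {t e : T n} (te : phi_pair t e).

Lemma pair_ttt : t * (t * t) = t. Proof. by case: te. Qed.
Lemma pair_te : t * e = e. Proof. by case: te. Qed.
Lemma pair_et : e * t = e. Proof. by case: te. Qed.
Lemma pair_ee : e * e = e. Proof. by case: te. Qed.

Lemma phi_mul0 s : phi t e s * e = e.
Proof.
by case: (phi_val t e s) => ->; rewrite ?expg2 -?mulgA ?pair_te ?pair_ee.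
Qed.

Lemma mul0_phi s : e * phi t e s = e.
Proof.
by case: (phi_val t e s) => ->; rewrite ?expg2 ?mulgA ?pair_et ?pair_ee.
Qed.

Lemma mul1_phi s : t ^+ 2 * phi t e s = phi t e s.
Proof.
by case: (phi_val t e s) => ->; rewrite expg2 -?mulgA ?pair_ttt ?pair_te.
Qed.

Lemma mul_phi1 s : phi t e s * t ^+ 2 = phi t e s.
Proof.
case: (phi_val t e s) => ->; rewrite expg2 -?mulgA ?pair_ttt //.
by rewrite mulgA !pair_et.
Qed.

Lemma phi_endo : phi t e \in EndT n.
Proof.
apply/endoP=> s u; case: (boolP (s \in symT n)) => [s_sym|s_sing]; last first.
  by rewrite !(phi_sing _ _ s) ?mul0_phi ?phi_sing // symT_mul negb_and s_sing.
case: (boolP (u \in symT n)) => [u_sym|u_sing]; last first.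
  rewrite !(phi_sing _ _ u) ?phi_mul0 ?phi_sing //.
  by rewrite symT_mul negb_and u_sing orbT.
have [/symTP[g ->] /symTP[h ->]] := (s_sym, u_sym).
rewrite -perm_transfM !phi_perm odd_permM.
by case: (odd_perm g); case: (odd_perm h); rewrite ?expg2 //= -?mulgA ?pair_ttt.
Qed.

End PhiPair.
Arguments phi_endo {n t e}.

(** In the image of [phi t e], [e] is the zero and [t ^+ 2] the identity, and
    [t] is the remaining element when there is one. *)
Lemma phi_im_inj {n} (t e t' e' : T n) : (1 < n)%N ->
    phi_pair t e -> phi_pair t' e' -> im (phi t e) = im (phi t' e') ->
  t = t' /\ e = e'.
Proof.
move=> n_gt1 te te' eq_im.
have [k _] := fresh_point [::] (ltnW n_gt1).
have [l kl] := fresh_point [:: k] n_gt1; rewrite inE in kl.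
have odd_kl: odd_perm (tperm l k) by rewrite odd_tperm.
have in_phi' s: exists s', phi t e s = phi t' e' s'.
  have: phi t e s \in im (phi t' e') by rewrite -eq_im mem_im.
  by case/imsetP=> s' _ ->; exists s'.
have in_phi s': exists s, phi t' e' s' = phi t e s.
  have: phi t' e' s' \in im (phi t e) by rewrite eq_im mem_im.
  by case/imsetP=> s _ ->; exists s.
have ee': e = e'.
  have [s'] := in_phi' (cst k); have [s] := in_phi (cst k).
  rewrite !(phi_sing _ _ (cst k)) ?cst_singular // => e's es'.
  by rewrite -(mul0_phi te s) -e's es' phi_mul0.
have tt': t ^+ 2 = t' ^+ 2.
  have [s'] := in_phi' 1; have [s] := in_phi 1.
  rewrite !phi_one => t's ts'.
  have <-: t ^+ 2 * t' ^+ 2 = t ^+ 2 by rewrite ts' mul_phi1.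
  by rewrite t's mul1_phi.
split=> //.
have [s'] := in_phi' (perm_transf (tperm l k)).
have [s] := in_phi (perm_transf (tperm l k)).
rewrite !phi_perm odd_kl => t's ts'.
case: (phi_val t' e' s') => E; rewrite E // -?tt' in ts'; last first.
  (* Here t = e, so the image is trivial. *)
  have t2: t ^+ 2 = e by rewrite ts' -ee' expg2 (pair_ee te).
  by case: (phi_val t e s) => E'; rewrite E' in t's; rewrite t's ?t2 // ts' ee'.
case: (phi_val t e s) => E'; rewrite E' in t's; rewrite t's //.
have: t' ^+ 2 = e by rewrite t's expg2 (pair_ee te).
by rewrite -tt' -ts'.
Qed.

(** * Endomorphisms that are injective on the symmetric group *)

(** The elements a(g) act as permutations on the image of the idempotent a(1)
    and are determined by this action.  Extending each action by the identity
    outside that image gives an injective, hence surjective, map from S_n to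
    itself; but no transposition moving a point outside the image of a(1) is
    reached, so a(1) fixes every point. *)
Lemma endo_unit_inj {n} (a : transf (T n)) : a \in EndT n ->
    injective (fun g => a (perm_transf g)) ->
  a 1 = 1 /\ forall h : 'S_n, exists g, a (perm_transf g) = perm_transf h.
Proof.
move=> /endoP aM a_inj; pose e0 := a 1; pose b g := a (perm_transf g).
have bM g h: b (g * h) = b g * b h by rewrite /b perm_transfM aM.
have eb g: e0 * b g = b g by rewrite -aM mul1g.
have be g: b g * e0 = b g by rewrite -aM mulg1.
have bV g: b g * b g^-1 = e0 by rewrite -bM mulgV /b perm_transf1.
have e0_fix g x: e0 (b g x) = b g x by rewrite -transf_mulE be.
pose q g : T n := [ffun x => if e0 x == x then b g x else x].
have q_inj g: injective (q g).
  move=> x y; rewrite !ffunE; case: eqP => [ex|ex]; case: eqP => [ey|ey] //.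
  - by move/(congr1 (b g^-1)); rewrite -!transf_mulE bV ex ey.
  - by move=> xy; case: ey; rewrite -xy e0_fix.
  - by move=> xy; case: ex; rewrite xy e0_fix.
pose p g := perm (q_inj g).
have p_inj: injective p.
  move=> g h /permP pgh; apply: a_inj; rewrite -/(b g) -/(b h).
  apply/ffunP=> x; rewrite -(eb g) -(eb h) !transf_mulE.
  have := pgh (e0 x); rewrite !permE !ffunE.
  by rewrite -transf_mulE -aM mul1g eqxx.
have [p' _ p'K] := injF_bij p_inj.
have e0_id x: e0 x = x.
  apply/eqP/idPn=> ex.
  have := permE (q_inj (p' (tperm x (e0 x)))) x.
  rewrite -/(p _) p'K tpermL ffunE.
  by rewrite (negbTE ex) => /eqP; apply/negP.
have a1: a 1 = 1 by apply/ffunP=> x; rewrite e0_id transf_oneE.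
split=> // h; exists (p' h); apply/ffunP=> x.
by rewrite -[in RHS](p'K h) !ffunE permE ffunE e0_id eqxx.
Qed.

(** The constants are the right zeros of T_n, and s can be read off from the
    products cst x * s = cst (s x); so a collision between any two maps is
    inherited by two constants, and then by all of them. *)
Lemma endo_inj {n} (a : transf (T n)) : (1 < n)%N -> a \in EndT n ->
  injective (fun g => a (perm_transf g)) -> injective a.
Proof.
move=> n_gt1 a_end a_inj; have [_ a_onto] := endo_unit_inj a a_end a_inj.
have aM := endoP a_end.
move=> s s' ass'; apply/ffunP=> x; apply/eqP/idPn=> sx.
have acst: a (cst (s x)) = a (cst (s' x)) by rewrite -!cst_mul !aM ass'.
(* Some permutation takes the pair (s x, s' x) to any given pair (k, l). *)
have acst_eq k l : a (cst k) = a (cst l).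
  have [->//|kl] := eqVneq k l.
  pose g := tperm (s x) k; pose h := tperm (g (s' x)) l.
  have gh1 : (g * h) (s x) = k.
    rewrite permM tpermL tpermD // 1?eq_sym //.
    apply: contraNneq sx => gs; apply/eqP/(@perm_inj _ g).
    by rewrite -gs tpermL.
  have gh2 : (g * h) (s' x) = l by rewrite permM tpermL.
  have E y: cst ((g * h) y) = cst y * perm_transf (g * h).
    by rewrite cst_mul ffunE.
  by rewrite -gh1 -gh2 !E !aM acst.
pose z := a (cst (s x)).
(* a maps S_n onto S_n, and cst k * g is again a constant. *)
have z_fix h: z * perm_transf h = z.
  by have [g <-] := a_onto h; rewrite -aM cst_mul; apply: acst_eq.
have [y] := fresh_point [:: z x] n_gt1; rewrite inE; case/eqP.
have /ffunP/(_ x) := z_fix (tperm (z x) y).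
by rewrite transf_mulE ffunE tpermL.
Qed.

(** * Endomorphisms that are not injective on the symmetric group *)

Lemma Sym_centerless {n} (g : 'S_n) : (3 <= n)%N -> g != 1 ->
  exists h : 'S_n, [~ g, h] != 1.
Proof.
move=> n3 g_n1; have [x gx]: exists x, g x != x.
  apply/existsP; apply: contraR g_n1 => /existsPn gfix.
  by apply/eqP/permP=> x; rewrite perm1; move/negbNE/eqP: (gfix x).
have [z] := fresh_point [:: x; g x] n3.
rewrite !inE !negb_or => /andP[zx zg].
exists (tperm (g x) z); apply/negP=> /commgP/permP/(_ x).
rewrite !permM tpermL tpermD // => /eqP.
by rewrite (negbTE zg).
Qed.

(** A nontrivial element of the kernel does not commute with some permutation,
    and the commutator is a nontrivial even element of the kernel; the kernel
    thus meets the simple group A_n in a nontrivial normal subgroup. *)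
Lemma alt_in_kernel {n} (a : transf (T n)) : (5 <= n)%N -> a \in EndT n ->
    ~ injective (fun g => a (perm_transf g)) ->
  forall g, ~~ odd_perm g -> a (perm_transf g) = a 1.
Proof.
move=> n5 /endoP aM a_ninj; pose b g := a (perm_transf g).
have bM g h: b (g * h) = b g * b h by rewrite /b perm_transfM aM.
have b1l g: b 1 * b g = b g by rewrite -bM mul1g.
pose K := [set g | b g == b 1].
have K_group: group_set K.
  apply/group_setP; split=> [|g h]; rewrite !inE // => /eqP bg /eqP bh.
  by rewrite bM bg bh b1l.
pose KG := group K_group.
have K_normal: KG <| [set: 'S_n].
  rewrite /normal subsetT; apply/subsetP=> g _; rewrite inE.
  apply/subsetP=> _ /imsetP[h hK ->]; rewrite !inE in hK *.
  by rewrite !bM (eqP hK) b1l -bM mulVg.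
have KA_normal: 'Alt_('I_n) :&: KG <| 'Alt_('I_n).
  by apply: normalGI K_normal; rewrite subsetT.
have Alt_simple : simple 'Alt_('I_n) by apply: simple_Alt5; rewrite card_ord.
have [_ /(_ _ KA_normal)[KA1|KA]] := simpleP _ Alt_simple.
  case: a_ninj => g h bgh; apply/eqP; rewrite eq_mulgV1; apply/idPn=> gh1.
  have [k] := Sym_centerless _ (leq_trans (isT : 3 <= 5)%N n5) gh1; case/eqP.
  apply/set1gP; rewrite -KA1 inE Alt_even commgEl.
  rewrite odd_permM odd_permV odd_permJ addbb /=.
  have ghK : g * h^-1 \in KG by rewrite inE bM [b g]bgh -/(b h) -bM mulgV.
  by rewrite -[K]/(gval KG) groupM ?groupV //
    memJ_norm // (subsetP (normal_norm K_normal)).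
move=> g g_even; apply/eqP; rewrite -perm_transf1 -/(b g) -/(b 1).
have: g \in 'Alt_('I_n) :&: KG by rewrite KA Alt_even.
by rewrite !inE => /andP[].
Qed.

(** An odd permutation with the required values is corrected by transposing two
    further points; this is where four points are needed. *)
Lemma alt_2transitive {n} (i j i' j' : 'I_n) :
    (4 <= n)%N -> i != j -> i' != j' ->
  exists g : 'S_n, [/\ ~~ odd_perm g, g i = i' & g j = j'].
Proof.
move=> n4 ij ij'; pose g := tperm i i' * tperm (tperm i i' j) j'.
have gi: g i = i'.
  have i'j : tperm i i' j != i'.
    by rewrite -{2}(tpermL i i') (inj_eq perm_inj) eq_sym.
  by rewrite permM tpermL tpermD // eq_sym.
have gj: g j = j' by rewrite permM tpermL.
clearbody g; have [g_odd|g_even] := boolP (odd_perm g); last by exists g.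
have [k] := fresh_point [:: i'; j'] (leq_trans (isT : 2 < 4)%N n4).
have [l] := fresh_point [:: i'; j'; k] n4.
rewrite !inE !negb_or => /and3P[li' lj' lk] /andP[ki' kj'].
exists (g * tperm k l); rewrite odd_permM g_odd odd_tperm eq_sym lk.
by rewrite !permM gi gj !tpermD.
Qed.

Definition collapse {n} (i j : 'I_n) : T n :=
  [ffun x => if x == i then j else x].

Lemma collapse_mul {n} (s : T n) i j : s i = s j -> collapse i j * s = s.
Proof.
move=> sij; apply/ffunP=> x; rewrite transf_mulE ffunE.
by case: eqP => // ->.
Qed.

Lemma mul_collapse {n} (s : T n) i j :
  (forall x, s x != i) -> s * collapse i j = s.
Proof.
by move=> si; apply/ffunP=> x; rewrite transf_mulE ffunE (negbTE (si x)).
Qed.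

Lemma collapse_idem {n} (i j : 'I_n) :
  collapse i j * collapse i j = collapse i j.
Proof. by apply: collapse_mul; rewrite !ffunE eqxx; case: ifP. Qed.

Lemma singular_missed {n} (s : T n) :
  s \notin symT n -> exists i, forall x, s x != i.
Proof.
move=> s_sing.
suff /existsP[i /forallP] : [exists i, [forall x, s x != i]] by exists i.
apply: contraR s_sing => /existsPn s_onto.
have s_surj i : exists x, s x == i.
  by have := s_onto i; rewrite negb_forall => /existsP[x /negbNE]; exists x.
pose r i := xchoose (s_surj i).
have rK : cancel r s by move=> i; apply/eqP: (xchooseP (s_surj i)).
have [r' _ r'K] := injF_bij (can_inj rK).
by apply/symT_injP=> x y; rewrite -[x]r'K -[y]r'K !rK => ->.
Qed.

(** The idempotents [collapse i j] with i != j are conjugate under the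
    alternating group, which [a] sends to its identity a(1). *)
Lemma endo_collapse {n} (a : transf (T n)) : (4 <= n)%N -> a \in EndT n ->
    (forall g, ~~ odd_perm g -> a (perm_transf g) = a 1) ->
  forall i j i' j', i != j -> i' != j' -> a (collapse i j) = a (collapse i' j').
Proof.
move=> n4 /endoP aM a_even i j i' j' ij ij'.
have [g [g_even gi gj]] := alt_2transitive i j i' j' n4 ij ij'.
have : collapse i j * perm_transf g = perm_transf g * collapse i' j'.
  apply/ffunP=> x; rewrite !transf_mulE !ffunE -gi -gj (inj_eq perm_inj).
  by case: ifP.
by move/(congr1 a); rewrite !aM !a_even // -!aM mulg1 mul1g.
Qed.

(** The constant [cst k] is the product of the [collapse j k] over the points
    j != k, all of which have the same idempotent image. *)
Lemma endo_singular {n} (a : transf (T n)) : (4 <= n)%N -> a \in EndT n ->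
    (forall g, ~~ odd_perm g -> a (perm_transf g) = a 1) ->
  forall k s, s \notin symT n -> a s = a (cst k).
Proof.
move=> n4 a_end a_even k s s_sing; have aM := endoP a_end.
have a_col := endo_collapse a n4 a_end a_even.
have [m] := fresh_point [:: k] (leq_trans (isT : 1 < 4)%N n4).
rewrite inE => mk.
have ee : a (collapse m k) * a (collapse m k) = a (collapse m k).
  by rewrite -aM collapse_idem.
(* c l sends the points of l to k: the partial products leading to cst k. *)
pose c (l : seq 'I_n) : T n := [ffun x => if x \in l then k else x].
have ac j l : k \notin j :: l -> a (c (j :: l)) = a (collapse m k).
  elim: l j => [|i l IH] j; rewrite in_cons negb_or => /andP[kj kl].
    have -> : c [:: j] = collapse j k by apply/ffunP=> x; rewrite !ffunE inE.
    by apply: a_col; rewrite // eq_sym.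
  have -> : c [:: j, i & l] = collapse j k * c (i :: l).
    apply/ffunP=> x; rewrite transf_mulE !ffunE inE; case: eqP => //= _.
    by rewrite (negbTE kl).
  by rewrite aM IH // (a_col j k m k) // eq_sym.
have a_cst : a (cst k) = a (collapse m k).
  rewrite -(ac m (enum (predC1 k))) ?inE ?mem_enum ?inE ?eqxx ?orbF 1?eq_sym //.
  suff <- : c (m :: enum (predC1 k)) = cst k by [].
  apply/ffunP=> x; rewrite !ffunE inE mem_enum inE.
  by case: (eqVneq x k) => [->|]; rewrite ?orbT ?orbF //; case: ifP.
have [i si] := singular_missed s s_sing.
have [j] := fresh_point [:: i] (leq_trans (isT : 1 < 4)%N n4).
rewrite inE eq_sym => ij.
have a_k : a (cst k) = a (collapse i j) by rewrite a_cst (a_col m k i j).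
by rewrite -{1}(mul_collapse s i j si) aM -a_k -aM mul_cst.
Qed.

(** The part of the Schein-Teclezghi theorem that concerns the singular
    endomorphisms: [t] is the image of a transposition, [e] that of a
    constant. *)
Lemma singular_endo {n} (a : transf (T n)) : (5 <= n)%N -> a \in EndT n ->
  a \notin AutT n -> exists t e : T n, phi_pair t e /\ a = phi t e.
Proof.
move=> n5 a_end a_sing; have aM := endoP a_end.
have n_gt1 : (1 < n)%N by apply: leq_trans n5.
have a_even : forall g, ~~ odd_perm g -> a (perm_transf g) = a 1.
  apply: alt_in_kernel => // a_inj; case/negP: a_sing.
  by apply/(AutTP _ a_end)/endo_inj.
have [k _] := fresh_point [::] (ltnW n_gt1).
have [l kl] := fresh_point [:: k] n_gt1; rewrite inE in kl.
pose r := tperm l k; have r_odd : odd_perm r by rewrite odd_tperm.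
pose t := a (perm_transf r); pose e := a (cst k).
have ae s : s \notin symT n -> a s = e.
  by apply: endo_singular => //; apply: ltnW.
have tt : t ^+ 2 = a 1 by rewrite expg2 -aM -perm_transfM tperm2 perm_transf1.
exists t, e; split.
  split.
  - by rewrite expgS tt -aM mulg1.
  - by rewrite -aM mul_cst.
  - by rewrite -aM cst_mul ae ?cst_singular.
  - by rewrite expg2 -aM mul_cst.
apply/ffunP=> s.
case: (boolP (s \in symT n)) => [/symTP[g ->]|s_sing]; last first.
  by rewrite phi_sing ?ae.
rewrite phi_perm; case: ifP => [g_odd|/negbT/a_even ->] //.
have -> : g = (g * r) * r by rewrite -mulgA tperm2 mulg1.
rewrite perm_transfM aM a_even ?odd_permM ?g_odd ?r_odd //.
by rewrite -aM mul1g.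
Qed.

(** * Images and principal left ideals *)

Lemma im_endo {n} (a b : transf (T n)) : (5 <= n)%N ->
    a \in EndT n -> b \in EndT n -> im a = im b ->
  a = b \/ (a \in AutT n /\ b \in AutT n).
Proof.
move=> n5 a_end b_end im_ab.
have autE : (b \in AutT n) = (a \in AutT n) by rewrite !AutT_im // im_ab.
rewrite autE; case: (boolP (a \in AutT n)) => [|a_sing]; first by right.
have b_sing : b \notin AutT n by rewrite autE.
have [t [e [te aE']]] := singular_endo _ n5 a_end a_sing.
have [t' [e' [te' bE']]] := singular_endo _ n5 b_end b_sing.
rewrite aE' bE' in im_ab *; left.
have n_gt1 : (1 < n)%N by apply: leq_trans n5.
by have [-> ->] := phi_im_inj _ _ _ _ n_gt1 te te' im_ab.
Qed.

Lemma mul_phi {n} (t e u f : T n) : phi_pair t e ->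
  phi u f * phi t e = phi (phi t e u) (phi t e f).
Proof.
move=> te; have := endoP (phi_endo te); move: (phi t e) => b bM.
apply/ffunP=> s; rewrite transf_mulE !ffunE.
by case: ifP => // _; case: ifP => // _; rewrite !expg2 bM.
Qed.

(** If c = phi u f, the product is phi (phi t e u) (phi t e f), which depends
    only on the classes (odd, even or singular) of u and f.  All four elements
    arise: from c = 1 and from c = phi u f with (u, f) equal to (1, cst k),
    (cst k, cst k) or (1, 1). *)
Lemma lideal_phi {n} (t e : T n) : (5 <= n)%N -> phi_pair t e ->
  lideal (phi t e) = [set phi t e; phi_plus t e; phi_minus t e; phi_zero t e].
Proof.
move=> n5 te; have n_gt1 : (1 < n)%N by apply: leq_trans n5.
have te_end := phi_endo te.
apply/setP=> b; rewrite !inE -!orbA; apply/imsetP/or4P => [[c c_end ->]|].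
  case: (boolP (c \in AutT n)) => [/(AutTP _ c_end) c_inj|/singular_endo].
    have c_onto s : exists s', c s' = s.
      by have [c' _ c'K] := injF_bij c_inj; exists (c' s).
    have ca_end : c * phi t e \in EndT n.
      by apply/endoP=> s u; rewrite !transf_mulE (endoP c_end) (endoP te_end).
    (* Precomposing with a bijection keeps the image, and that image determines
       phi t e. *)
    have im_ca : im (c * phi t e) = im (phi t e).
      apply/setP=> s; apply/imsetP/imsetP=> [[u _ ->]|[u _ ->]].
        by exists (c u); rewrite ?transf_mulE.
      by have [v <-] := c_onto u; exists v; rewrite ?transf_mulE.
    have := im_endo _ _ n5 ca_end te_end im_ca.
    case=> [->|[_ /(AutTP _ te_end) phi_inj]].
      by constructor 1.
    have [k _] := fresh_point [::] (ltnW n_gt1).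
    have [l] := fresh_point [:: k] n_gt1; rewrite inE; case/eqP.
    by apply/cst_inj/phi_inj; rewrite !phi_sing ?cst_singular.
  case=> // u [f [uf ->]]; rewrite mul_phi //.
  case: (boolP (f \in symT n)) => [f_sym|f_sing].
    (* The only invertible idempotent is 1, and u f = f then forces u = 1. *)
    have f1 : f = 1 by apply: idem_symT => //; apply: pair_ee uf.
    have u1 : u = 1 by rewrite -[u]mulg1 -f1; apply: pair_te uf.
    by constructor 4; rewrite f1 u1 phi_one.
  rewrite (phi_sing _ _ f) //.
  case: (boolP (u \in symT n)) => [/symTP[g ->]|u_sing].
    by rewrite phi_perm; case: ifP => _; [constructor 1|constructor 2].
  by rewrite (phi_sing _ _ u) //; constructor 3.
have [k _] := fresh_point [::] (ltnW n_gt1).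
have kk : cst k * cst k = cst k by rewrite mul_cst.
case=> /eqP ->.
- exists 1; last by rewrite mul1g.
  by apply/endoP=> s u; rewrite !transf_oneE.
- exists (phi 1 (cst k)).
    by apply: phi_endo; split; rewrite ?expg1n ?mul1g ?mulg1 ?expg2.
  by rewrite mul_phi // phi_one phi_sing ?cst_singular.
- exists (phi (cst k) (cst k)).
    by apply: phi_endo; split; rewrite // ?expgS ?expg0 ?mulg1 ?kk.
  by rewrite mul_phi // phi_sing ?cst_singular.
- exists (phi 1 1); last by rewrite mul_phi // phi_one.
  by apply: phi_endo; split; rewrite ?expg1n ?mulg1.
Qed.

Lemma lideal_self {n} (a : transf (T n)) : a \in lideal a.
Proof.
apply/imsetP; exists 1; last by rewrite mul1g.
by apply/endoP=> s u; rewrite !transf_oneE.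
Qed.

Lemma lideal_im {n} (a b : transf (T n)) : a \in lideal b -> im a \subset im b.
Proof.
case/imsetP=> c _ ->; apply/subsetP=> _ /imsetP[s _ ->].
by rewrite transf_mulE mem_im.
Qed.

Lemma lideal_Aut {n} (a : transf (T n)) : a \in AutT n -> lideal a = EndT n.
Proof.
move=> a_aut; have a_end : a \in EndT n by case/setIdP: a_aut.
have aM := endoP a_end; have /(AutTP _ a_end) a_inj := a_aut.
apply/setP=> c; apply/imsetP/idP => [[d d_end ->]|c_end].
  by apply/endoP=> s u; rewrite !transf_mulE (endoP d_end) aM.
have [a' aK a'K] := injF_bij a_inj.
exists [ffun s => a' (c s)]; last first.
  by apply/ffunP=> s; rewrite transf_mulE ffunE a'K.
by apply/endoP=> s u; apply: a_inj; rewrite aM !ffunE !a'K (endoP c_end).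
Qed.

Theorem proposition5p1 (n : nat) (hn : (5 <= n)%N)
    (a b : transf (T n)) (ha : a \in EndT n) (hb : b \in EndT n) :
  (a \notin AutT n ->
     exists t e : T n,
       [/\ [/\ t ^+ 3 = t, t * e = e, e * t = e & e ^+ 2 = e],
           a = phi t e
         & lideal a = [set a; phi_plus t e; phi_minus t e; phi_zero t e]])
  /\ ((greenL a b <-> im a = im b)
      /\ (im a = im b <-> a = b \/ (a \in AutT n /\ b \in AutT n))).
Proof.
have im_iff : im a = im b <-> a = b \/ (a \in AutT n /\ b \in AutT n).
  split=> [|[->|[]]] //; first exact: im_endo.
  by rewrite !AutT_im // => /eqP -> /eqP ->.
split=> [/(singular_endo _ hn ha)[t [e [te ->]]]|].
  by exists t, e; split=> //; apply: lideal_phi.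
split=> //; split=> [ab|/im_iff[->|[a_aut b_aut]]] //.
  apply/eqP; rewrite eqEsubset !lideal_im //.
    by rewrite ab lideal_self.
  by rewrite -ab lideal_self.
by rewrite /greenL !lideal_Aut.
Qed.
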